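(* In type $\tilde D$, the following relation holds for $n\ge 4$: $$\tilde D_{n+2}^{CFCI}(q)=\tilde D_{n+1}^{CFCI}(q)+q\,\tilde D_n^{CFCI}(q),$$ with $\tilde D_4^{CFCI}(q)=1+5q+6q^2+4q^3+q^4$ and $\tilde D_5^{CFCI}(q)=1+6q+10q^2+6q^3+q^4$. Therefore, $$\tilde D^{CFCI}(x):=\sum_{n=2}^{\infty}\tilde D_{n+2}^{CFCI}(q)x^n=x^2\,\frac{1+5q+6q^2+4q^3+q^4+x(q+4q^2+2q^3)}{1-x-qx^2}.$$
   Context: For $n\ge2$, $\tilde D_{n+2}$ is the affine Coxeter group with generators $t_1,t_2,s_1,\dots,s_{n-1},u_1,u_2$ whose Coxeter diagram has edges $t_1-s_1$, $t_2-s_1$, $s_i-s_{i+1}$ ($1\le i\le n-2$), $s_{n-1}-u_1$, $s_{n-1}-u_2$, all with $m=3$. An element of a Coxeter group $W$ (with length $\ell$) is fully commutative (FC) if any two of its reduced expressions are related by a sequence of transpositions of adjacent commuting generators. A cyclic shift of a word $s_{i_1}\cdots s_{i_k}$ is any word $s_{i_j}\cdots s_{i_k}s_{i_1}\cdots s_{i_{j-1}}$. An element is cyclically fully commutative (CFC) if every cyclic shift of every one of its reduced expressions is a reduced expression of an FC element; $W^{CFC}$ is the set of CFC elements. $I(W)=\{w\in W:w^2=1\}$ (including the identity), and $W^{CFCI}(q):=\sum_{w\in W^{CFC}\cap I(W)}q^{\ell(w)}$. *)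

(* Defs.v *)
From Stdlib Require Import Relations.Relation_Operators.
From HB Require Import structures.
From mathcomp Require Import all_boot all_order all_algebra.
From mathcomp Require Import generic_quotient finmap.
From mathcomp Require Import boolp classical_sets functions cardinality fsbigop.

Set Implicit Arguments.
Unset Strict Implicit.
Unset Printing Implicit Defensive.

Import GRing.Theory.

Local Open Scope quotient_scope.

(* Coxeter groups, as quotients of the free monoid on the generators. The     *)
(* congruence is generated by (st)^{m(s,t)} = 1; since m(s,s) = 1 each        *)
(* generator is an involution, so this monoid is the Coxeter group. The value *)
(* 0 stands for m(s,t) = infinity: the corresponding relator is empty.        *)

Record coxeter_matrix (S : finType) := CoxeterMatrix {
  cox_mx :> S -> S -> nat;
  cox_mx_sym : forall s t, cox_mx s t = cox_mx t s;
  cox_mx_eq1 : forall s t, (cox_mx s t == 1) = (s == t)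
}.

Section CoxeterGroup.
Variables (S : finType) (m : coxeter_matrix S).

Definition relator (s t : S) : seq S := flatten (nseq (m s t) [:: s; t]).

Variant cox_step : seq S -> seq S -> Prop :=
  CoxStep u s t v : cox_step (u ++ relator s t ++ v) (u ++ v).

Definition cox_equiv : seq S -> seq S -> Prop :=
  clos_refl_sym_trans (seq S) cox_step.

Lemma cox_equiv_refl u : cox_equiv u u. Proof. exact: rst_refl. Qed.

Lemma cox_equiv_sym u v : cox_equiv u v -> cox_equiv v u.
Proof. exact: rst_sym. Qed.

Lemma cox_equiv_trans v u w : cox_equiv u v -> cox_equiv v w -> cox_equiv u w.
Proof. exact: rst_trans. Qed.

Lemma cox_equiv_catl w u v : cox_equiv u v -> cox_equiv (w ++ u) (w ++ v).
Proof.
elim=> [_ _ [x s t y]|x|x y _|x y z _ + _].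
- by apply: rst_step; rewrite !(catA w); exact: CoxStep.
- exact: cox_equiv_refl.
- exact: cox_equiv_sym.
- exact: cox_equiv_trans.
Qed.

Lemma cox_equiv_catr w u v : cox_equiv u v -> cox_equiv (u ++ w) (v ++ w).
Proof.
elim=> [_ _ [x s t y]|x|x y _|x y z _ + _].
- by apply: rst_step; rewrite -!catA; exact: CoxStep.
- exact: cox_equiv_refl.
- exact: cox_equiv_sym.
- exact: cox_equiv_trans.
Qed.

Lemma cox_equiv_cat u u' v v' :
  cox_equiv u u' -> cox_equiv v v' -> cox_equiv (u ++ v) (u' ++ v').
Proof.
move=> uu' vv'; apply: (@cox_equiv_trans (u' ++ v)).
  exact: cox_equiv_catr.
exact: cox_equiv_catl.
Qed.

Lemma rev_relator s t : rev (relator s t) = relator t s.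
Proof.
rewrite /relator cox_mx_sym; elim: (m t s) => //= k.
by rewrite !rev_cons => ->; elim: k => //= k ->.
Qed.

Lemma cox_equiv_rev u v : cox_equiv u v -> cox_equiv (rev u) (rev v).
Proof.
elim=> [_ _ [x s t y]|x|x y _|x y z _ + _].
- rewrite !rev_cat rev_relator -catA; apply: rst_step; exact: CoxStep.
- exact: cox_equiv_refl.
- exact: cox_equiv_sym.
- exact: cox_equiv_trans.
Qed.

Lemma cox_equiv_cat_rev u : cox_equiv (u ++ rev u) [::].
Proof.
elim: u => [|s u IH]; first exact: cox_equiv_refl.
apply: (@cox_equiv_trans [:: s; s]).
  rewrite rev_cons -cats1 -cat1s -!catA -[[:: s; s]]/([:: s] ++ [::] ++ [:: s]).
  by rewrite (catA u); apply/cox_equiv_catl/cox_equiv_catr.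
have /eqP ms : m s s == 1 by rewrite cox_mx_eq1.
by have := CoxStep [::] s s [::]; rewrite /relator ms => /= ?; exact: rst_step.
Qed.

Definition cox_eqb (u v : seq S) : bool := `[< cox_equiv u v >].

Lemma cox_eqb_equiv : equiv_class_of cox_eqb.
Proof.
split=> [u|u v|v u w].
- exact/asboolP/cox_equiv_refl.
- by apply/asboolP/asboolP; exact: cox_equiv_sym.
- by move=> /asboolP uv /asboolP vw; exact/asboolP/(cox_equiv_trans uv).
Qed.

Canonical cox_equiv_rel := EquivRelPack cox_eqb_equiv.

Definition coxeter_group : Type := {eq_quot cox_equiv_rel}.
HB.instance Definition _ := Choice.on coxeter_group.

Definition cox_pi (u : seq S) : coxeter_group := \pi_{eq_quot cox_equiv_rel} u.
Definition cox_repr (w : coxeter_group) : seq S :=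
  @repr _ {eq_quot cox_equiv_rel} w.

Lemma cox_reprK w : cox_pi (cox_repr w) = w. Proof. exact: reprK. Qed.

Lemma cox_piP u v : cox_pi u = cox_pi v <-> cox_equiv u v.
Proof.
by split=> [/eqquotP /asboolP|uv]; last exact/eqquotP/asboolP.
Qed.

Lemma cox_piK u : cox_equiv (cox_repr (cox_pi u)) u.
Proof. by apply/cox_piP; rewrite cox_reprK. Qed.

Definition cox_one : coxeter_group := cox_pi [::].
Definition cox_mul (v w : coxeter_group) : coxeter_group :=
  cox_pi (cox_repr v ++ cox_repr w).
Definition cox_inv (w : coxeter_group) : coxeter_group :=
  cox_pi (rev (cox_repr w)).

Lemma cox_mul_pi u v : cox_mul (cox_pi u) (cox_pi v) = cox_pi (u ++ v).
Proof. by apply/cox_piP/cox_equiv_cat; exact: cox_piK. Qed.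

Lemma cox_mulA : associative cox_mul.
Proof.
move=> x y z; rewrite -(cox_reprK x) -(cox_reprK y) -(cox_reprK z).
by rewrite !cox_mul_pi catA.
Qed.

Lemma cox_mul1 : left_id cox_one cox_mul.
Proof. by move=> x; rewrite -(cox_reprK x) cox_mul_pi. Qed.

Lemma cox_mulr1 : right_id cox_one cox_mul.
Proof. by move=> x; rewrite -(cox_reprK x) cox_mul_pi cats0. Qed.

Lemma cox_mulV : right_inverse cox_one cox_inv cox_mul.
Proof.
move=> x; rewrite -{1}(cox_reprK x) cox_mul_pi.
exact/cox_piP/cox_equiv_cat_rev.
Qed.

Lemma cox_mulVr : left_inverse cox_one cox_inv cox_mul.
Proof.
move=> x; rewrite -{2}(cox_reprK x) cox_mul_pi; apply/cox_piP.
by rewrite -{2}(revK (cox_repr x)); exact: cox_equiv_cat_rev.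
Qed.

HB.instance Definition _ := isGroup.Build coxeter_group
  cox_mulA cox_mul1 cox_mulr1 cox_mulVr cox_mulV.

Definition cox_gen (s : S) : coxeter_group := cox_pi [:: s].

Definition word_val (u : seq S) : coxeter_group := (\prod_(s <- u) cox_gen s)%g.

Lemma word_valE u : word_val u = cox_pi u.
Proof.
rewrite /word_val; elim: u => [|s u IH]; first by rewrite big_nil.
by rewrite big_cons IH; exact: cox_mul_pi.
Qed.

Lemma ex_word_size (w : coxeter_group) :
  exists k, `[< exists2 u, word_val u = w & size u = k >].
Proof.
exists (size (cox_repr w)); apply/asboolP; exists (cox_repr w) => //.
by rewrite word_valE cox_reprK.
Qed.

Definition cox_length (w : coxeter_group) : nat := ex_minn (ex_word_size w).

Definition reduced_expr (u : seq S) (w : coxeter_group) : Prop :=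
  word_val u = w /\ size u = cox_length w.

Variant comm_swap : seq S -> seq S -> Prop :=
  CommSwap u s t v : commute (cox_gen s) (cox_gen t) ->
    comm_swap (u ++ s :: t :: v) (u ++ t :: s :: v).

Definition fully_commutative (w : coxeter_group) : Prop :=
  forall u v, reduced_expr u w -> reduced_expr v w ->
    clos_refl_trans (seq S) comm_swap u v.

Definition cyclically_fully_commutative (w : coxeter_group) : Prop :=
  forall u, reduced_expr u w -> forall i,
    exists2 w', reduced_expr (rot i u) w' & fully_commutative w'.

Definition CFCI : set coxeter_group :=
  [set w | cyclically_fully_commutative w /\ (w ^+ 2 = 1)%g]%classic.

Lemma finite_cox_length k :
  finite_set [set w : coxeter_group | cox_length w = k]%classic.
Proof.
apply: (@sub_finite_set _ _ ((word_val \o @tval k S) @` setT)%classic).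
  move=> w /= <-; rewrite /cox_length; case: ex_minnP => _ /asboolP[u uw <-] _.
  by exists (in_tuple u).
exact/finite_image/finite_finset.
Qed.

End CoxeterGroup.

Arguments CFCI {S} m.

Local Open Scope ring_scope.

Record fps (R : Type) := FPS { fcoef : nat -> R }.

Lemma fpsP (R : Type) (a b : fps R) : fcoef a =1 fcoef b -> a = b.
Proof. by case: a b => [a] [b] /= /funext ->. Qed.

HB.instance Definition _ (R : Type) := gen_eqMixin (fps R).
HB.instance Definition _ (R : Type) := gen_choiceMixin (fps R).

Section FpsZmod.
Variable R : zmodType.
Implicit Types a b c : fps R.

Definition fps_zero : fps R := FPS (fun=> 0).
Definition fps_opp a : fps R := FPS (fun n => - fcoef a n).
Definition fps_add a b : fps R := FPS (fun n => fcoef a n + fcoef b n).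

Lemma fps_addA : associative fps_add.
Proof. by move=> a b c; apply: fpsP => n /=; rewrite addrA. Qed.

Lemma fps_addC : commutative fps_add.
Proof. by move=> a b; apply: fpsP => n /=; rewrite addrC. Qed.

Lemma fps_add0 : left_id fps_zero fps_add.
Proof. by move=> a; apply: fpsP => n /=; rewrite add0r. Qed.

Lemma fps_addN : left_inverse fps_zero fps_opp fps_add.
Proof. by move=> a; apply: fpsP => n /=; rewrite addNr. Qed.

HB.instance Definition _ := GRing.isZmodule.Build (fps R)
  fps_addA fps_addC fps_add0 fps_addN.

End FpsZmod.

Section FpsRing.
Variable R : comNzRingType.
Implicit Types a b c : fps R.

Definition fpsC (r : R) : fps R := FPS (fun n => if n == 0%N then r else 0).
Definition fpsX : fps R := FPS (fun n => (n == 1%N)%:R).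

Definition fps_mul a b : fps R :=
  FPS (fun n => \sum_(i < n.+1) fcoef a i * fcoef b (n - i)%N).

Let trunc N a : {poly R} := \poly_(i < N) fcoef a i.

Let coef_trunc N a n : (n < N)%N -> (trunc N a)`_n = fcoef a n.
Proof. by rewrite coef_poly => ->. Qed.

Let coef_fps_mul N a b n :
  (n < N)%N -> fcoef (fps_mul a b) n = (trunc N a * trunc N b)`_n.
Proof.
move=> nN; rewrite coefM; apply: eq_bigr => i _.
by rewrite !coef_trunc // (leq_ltn_trans _ nN) ?leq_subr // -ltnS.
Qed.

Let eq_coefM (p p' r r' : {poly R}) n :
    (forall i, (i <= n)%N -> p`_i = p'`_i) ->
    (forall i, (i <= n)%N -> r`_i = r'`_i) ->
  (p * r)`_n = (p' * r')`_n.
Proof.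
move=> pp' rr'; rewrite !coefM; apply: eq_bigr => i _.
by rewrite pp' ?rr' ?leq_subr // -ltnS.
Qed.

Lemma fps_mulA : associative fps_mul.
Proof.
move=> a b c; apply: fpsP => n; rewrite !(@coef_fps_mul n.+1) //.
transitivity ((trunc n.+1 a * (trunc n.+1 b * trunc n.+1 c))`_n).
  by apply: eq_coefM => // i ile; rewrite coef_trunc // -coef_fps_mul.
rewrite mulrA; apply: eq_coefM => // i ile.
by rewrite coef_trunc // -coef_fps_mul.
Qed.

Lemma fps_mulC : commutative fps_mul.
Proof. by move=> a b; apply: fpsP => n; rewrite !(@coef_fps_mul n.+1) // mulrC. Qed.

Lemma fps_mul1 : left_id (fpsC 1) fps_mul.
Proof.
move=> a; apply: fpsP => n /=; rewrite big_ord_recl /= mul1r subn0 big1 ?addr0 //.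
by move=> i _; rewrite mul0r.
Qed.

Lemma fps_mulDl : left_distributive fps_mul +%R.
Proof.
move=> a b c; apply: fpsP => n /=; rewrite -big_split /=.
by apply: eq_bigr => i _; rewrite mulrDl.
Qed.

Lemma fps_one_neq0 : fpsC 1 != 0.
Proof.
by apply/eqP => /(congr1 (fun a => fcoef a 0)) /eqP; rewrite /= oner_eq0.
Qed.

HB.instance Definition _ := GRing.Zmodule_isComNzRing.Build (fps R)
  fps_mulA fps_mulC fps_mul1 fps_mulDl fps_one_neq0.

Definition fps_unit : {pred fps R} := fun a => `[< exists b, b * a = 1 >].
Definition fps_inv a : fps R :=
  if pselect (exists b, b * a = 1) is left ex then xget a [set b | b * a = 1]%classic
  else a.

Lemma fps_mulV : {in fps_unit, left_inverse 1 fps_inv *%R}.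
Proof.
move=> a /asboolP ua; rewrite /fps_inv; case: pselect => // -[b ba].
by have := @xgetI _ a [set b | b * a = 1]%classic b ba.
Qed.

Lemma fps_unitPl a b : b * a = 1 -> fps_unit a.
Proof. by move=> ba; apply/asboolP; exists b. Qed.

Lemma fps_inv_out : {in [predC fps_unit], fps_inv =1 id}.
Proof.
by move=> a /asboolP; rewrite /fps_inv; case: pselect.
Qed.

HB.instance Definition _ := GRing.ComNzRing_hasMulInverse.Build (fps R)
  fps_mulV fps_unitPl fps_inv_out.

Fixpoint fps_inv_seq a n : seq R :=
  if n is k.+1 then
    let s := fps_inv_seq a k in
    rcons s (- \sum_(i < k.+1) s`_i * fcoef a (k.+1 - i)%N)
  else [:: 1].

Lemma fps_unit_coef0 a : fcoef a 0%N = 1 -> a \is a GRing.unit.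
Proof.
move=> a0; apply/asboolP; exists (FPS (fun n => (fps_inv_seq a n)`_n)).
have sz n : size (fps_inv_seq a n) = n.+1.
  by elim: n => //= n IH; rewrite size_rcons IH.
have stable n i : (i <= n)%N -> (fps_inv_seq a n)`_i = (fps_inv_seq a i)`_i.
  elim: n => [|n IH]; first by rewrite leqn0 => /eqP ->.
  rewrite leq_eqVlt => /orP[/eqP -> //|lt_in].
  by rewrite /= nth_rcons sz lt_in IH.
apply: fpsP => -[|n]; rewrite /= ?big_ord_recr ?big_ord0 /= ?subnn ?a0.
  by rewrite add0r mulr1.
rewrite nth_rcons sz ltnn eqxx mulr1.
rewrite [X in X + _](_ : _ = \sum_(i < n.+1)
    (fps_inv_seq a n)`_i * fcoef a (n.+1 - i)%N) ?big_ord_recr /= ?subrr //.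
by congr (_ + _); apply: eq_bigr => i _; rewrite [in RHS]stable // ltnW.
Qed.

End FpsRing.

(* The formal sum of q^(cox_length w) over w in CFCI, taken coefficientwise.  *)
(* Each coefficient is a finite sum by finite_cox_length.                     *)
Definition CFCI_series (S : finType) (m : coxeter_matrix S) : fps int :=
  FPS (fun k => \sum_(w \in CFCI m) fcoef (fpsX int ^+ cox_length w) k).

(* affineD k is the Coxeter matrix of affine D_k for k >= 4, that is, of      *)
(* affine D_{n+2} with k = n + 2. There, gT b ranges over t_1, t_2, gU b over *)
(* u_1, u_2, and gS i, i < k - 3 = n - 1, is s_{i+1}.                         *)
Inductive affineD_gen (k : nat) :=
  | gT of bool
  | gS of 'I_(k - 3)
  | gU of bool.

Section AffineD.
Variable k : nat.

Definition affineD_code (g : affineD_gen k) : bool + 'I_(k - 3) + bool :=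
  match g with gT b => inl (inl b) | gS i => inl (inr i) | gU b => inr b end.

Definition affineD_decode (x : bool + 'I_(k - 3) + bool) : affineD_gen k :=
  match x with
  | inl (inl b) => gT k b | inl (inr i) => gS i | inr b => gU k b
  end.

Lemma affineD_codeK : cancel affineD_code affineD_decode.
Proof. by case. Qed.

HB.instance Definition _ := Finite.copy (affineD_gen k) (can_type affineD_codeK).

Definition affineD_edge (g h : affineD_gen k) : bool :=
  match g, h with
  | gT _, gS i | gS i, gT _ => i == 0%N :> nat
  | gS i, gS j => (j == i.+1 :> nat) || (i == j.+1 :> nat)
  | gS i, gU _ | gU _, gS i => i.+1 == (k - 3)%N
  | _, _ => false
  end.

Definition affineD_mx (g h : affineD_gen k) : nat :=
  (if g == h then 1 else if affineD_edge g h then 3 else 2)%N.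

Lemma affineD_mx_sym g h : affineD_mx g h = affineD_mx h g.
Proof.
rewrite /affineD_mx eq_sym; suff -> : affineD_edge g h = affineD_edge h g by [].
by case: g h => [b|i|b] [c|j|c] //=; rewrite orbC.
Qed.

Lemma affineD_mx_eq1 g h : (affineD_mx g h == 1%N) = (g == h).
Proof. by rewrite /affineD_mx; case: (g == h) => //; case: affineD_edge. Qed.

Definition affineD : coxeter_matrix (affineD_gen k) :=
  CoxeterMatrix affineD_mx_sym affineD_mx_eq1.

End AffineD.

Definition affineD_CFCI (k : nat) : fps int := CFCI_series (affineD k).

(* An element of Z[[q]][[x]], encoded as fps (fps int). *)
Definition affineD_CFCI_gf : fps (fps int) :=
  FPS (fun n => if (2 <= n)%N then affineD_CFCI n.+2 else 0).

(* Main.v *)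
Require Import Defs.
From Stdlib Require Import Relations.Relation_Operators.
From HB Require Import structures.
From mathcomp Require Import all_boot all_order all_algebra.
From mathcomp Require Import boolp.
From mathcomp Require classical_sets functions fsbigop.
From mathcomp Require Import ring zify.

Set Implicit Arguments.
Unset Strict Implicit.
Unset Printing Implicit Defensive.

Import GRing.Theory.
Local Open Scope ring_scope.

(** A CFC involution of any Coxeter group is a product of distinct, pairwise
    commuting generators ([CFCI_comm_word], [CFCI_uniq]).  Let [u] be a reduced
    word of a CFC involution [w].  The reverse of [u] is again a reduced word of
    [w], so by full commutativity the two are linked by commutations; hence the
    first letter [s] of [u] can also be brought to the end of [u].  If the
    occurrence of [s] brought to the end is another one than the first letter,
    then a reduced word of [w] starts and ends with [s], one of its cyclic shifts
    starts with [s s], and this contradicts CFC.  So it is the same occurrence,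
    and [s] commutes with every letter of [u].

    Conversely, in a simply laced group each set [A] of pairwise commuting
    generators gives a CFC involution of length [#|A|], and distinct sets give
    distinct elements.  Both rest on the geometric representation: a word without
    [s] preserves the coordinate along the simple root of [s], while the product
    of [A] negates the simple roots of the elements of [A]; so every word of that
    product contains every element of [A] ([commuting_prod_support]).

    Thus the CFC involutions are counted by the independence polynomial of the
    Coxeter diagram ([CFCI_series_commuting]).  Deleting vertices along the
    affine diagram of type D, from one fork to the other, writes this polynomial
    in terms of a sequence [end_poly] with the recurrence of the Fibonacci
    polynomials ([affineD_CFCI_end_poly]), and the recurrence of the theorem
    follows.  Multiplied by [1 - x - q x ^ 2], the generating function keeps only
    its coefficients of [x ^ 2] and [x ^ 3], which come from the two initial
    values. *)

(** * CFC involutions are products of commuting generators *)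

Section Words.
Variables (S : finType) (m : coxeter_matrix S).
Implicit Types (s t : S) (u v : seq S) (w : coxeter_group m) (A : {set S}).

Definition gen_commute s t := commute (cox_gen m s) (cox_gen m t).

Lemma word_val_nil : word_val m [::] = 1%g.
Proof. by rewrite /word_val big_nil. Qed.

Lemma word_val_cons s u : word_val m (s :: u) = (cox_gen m s * word_val m u)%g.
Proof. by rewrite /word_val big_cons. Qed.

Lemma word_val_cat u v : word_val m (u ++ v) = (word_val m u * word_val m v)%g.
Proof. by rewrite /word_val big_cat. Qed.

Lemma cox_gen_sq s : (cox_gen m s * cox_gen m s = 1)%g.
Proof.
rewrite -word_val_nil -{2}[cox_gen m s]mulg1 -word_val_nil -!word_val_cons.
by rewrite !word_valE; apply/cox_piP; exact: (cox_equiv_cat_rev m [:: s]).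
Qed.

Lemma word_val_rev u : word_val m (rev u) = ((word_val m u)^-1)%g.
Proof.
apply/esym/(mulgI (word_val m u)); rewrite mulgV -word_val_cat -word_val_nil.
by rewrite !word_valE; apply/esym/cox_piP; exact: cox_equiv_cat_rev.
Qed.

Lemma gen_commute_word s v :
  (forall t, t \in v -> gen_commute s t) ->
  (cox_gen m s * word_val m v = word_val m v * cox_gen m s)%g.
Proof.
elim: v => [|t v IH] sv; first by rewrite word_val_nil mulg1 mul1g.
have st : commute (cox_gen m s) (cox_gen m t) by apply: sv; exact: mem_head.
rewrite word_val_cons mulgA st -!mulgA IH // => r rv.
by apply: sv; rewrite inE rv orbT.
Qed.

Lemma cox_length_le u : (cox_length (word_val m u) <= size u)%N.
Proof.
by rewrite /cox_length; case: ex_minnP => k _; apply; apply/asboolP; exists u.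
Qed.

Lemma ex_reduced w : exists u, reduced_expr u w.
Proof.
rewrite /reduced_expr /cox_length; case: ex_minnP => k /asboolP[u uw uk] _.
by exists u.
Qed.

Lemma reduced_expr_eq u v w :
  reduced_expr u w -> word_val m v = w -> size v = size u -> reduced_expr v w.
Proof. by case=> _ uk vw vu; split; rewrite ?vu. Qed.

Lemma comm_swap_val u v :
  clos_refl_trans (seq S) (comm_swap m) u v -> word_val m u = word_val m v.
Proof.
elim=> [_ _ [x s t y st]|//|x y z _ -> _ -> //].
rewrite !word_val_cat !word_val_cons; congr (_ * _)%g.
by rewrite mulgA st -mulgA.
Qed.

Lemma comm_swap_cons s u v :
  clos_refl_trans (seq S) (comm_swap m) u v ->
  clos_refl_trans (seq S) (comm_swap m) (s :: u) (s :: v).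
Proof.
elim=> [_ _ [x r t y rt]|x|x y z _ + _]; last exact: rt_trans.
  by apply: rt_step; rewrite -!cat_cons; exact: CommSwap.
exact: rt_refl.
Qed.

Definition comm_word u := forall s t, s \in u -> t \in u -> gen_commute s t.

(** Swaps are available between any two letters of the word, so commutations
    reach all its permutations. *)
Lemma perm_comm_swap u v : comm_word u -> perm_eq u v ->
  clos_refl_trans (seq S) (comm_swap m) u v.
Proof.
elim: u v => [|s u IH] v cu uv.
  by rewrite perm_sym in uv; rewrite (perm_nilP uv); exact: rt_refl.
have sv : s \in v by rewrite -(perm_mem uv) mem_head.
have cs t : t \in u -> gen_commute s t.
  by move=> tu; apply: cu; rewrite inE ?eqxx ?tu ?orbT.
case/splitPr: sv uv => a b uv.
have {}uv : perm_eq u (a ++ b).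
  by rewrite -(perm_cons s) (permPl uv) perm_catC /= perm_cons perm_catC.
have csa t : t \in a -> gen_commute s t.
  by move=> ta; apply: cs; rewrite (perm_mem uv) mem_cat ta.
have {}IH : clos_refl_trans (seq S) (comm_swap m) u (a ++ b).
  by apply: IH => // r t ru tu; apply: cu; rewrite inE ?ru ?tu orbT.
apply: rt_trans (comm_swap_cons s IH) _.
elim: a csa {uv IH} => [|r a IHa] csa; first exact: rt_refl.
apply: (@rt_trans _ _ _ (r :: s :: a ++ b)).
  apply: rt_step; apply: (@CommSwap _ m [::]); apply: csa; exact: mem_head.
by apply/comm_swap_cons/IHa => t ta; apply: csa; rewrite inE ta orbT.
Qed.

Lemma perm_word_val u v :
  comm_word u -> perm_eq u v -> word_val m u = word_val m v.
Proof. by move=> cu uv; exact/comm_swap_val/perm_comm_swap. Qed.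

(** The criterion for [s] to be brought to the end of the word by commutations.
    The recursion on the word makes its invariance under a swap a local check. *)
Fixpoint movable_last s u : Prop :=
  if u is t :: v then
    movable_last s v \/ t = s /\ (forall r, r \in v -> gen_commute s r)
  else False.

Lemma movable_last_rcons s u : movable_last s (rcons u s).
Proof. by elim: u => [|t u IH] /=; [right|left]. Qed.

Lemma movable_last_swap s u v : clos_refl_trans (seq S) (comm_swap m) u v ->
  movable_last s u -> movable_last s v.
Proof.
elim=> [_ _ [x r t y rt]|//|x y z _ + _ + xs]; last by move=> /(_ xs) ys; apply.
elim: x => [|a x IH] /=.
  case=> [[ys|[ts cy]]|[-> cty]]; first by left; left.
    right; split=> // b; rewrite inE => /predU1P[->|/cy//].
    by rewrite -ts; exact/esym.
  left; right; split=> // b yb; apply: cty; by rewrite inE yb orbT.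
case=> [/IH|[-> cx]]; [by left|right; split=> // b bx; apply: cx].
by move: bx; rewrite !mem_cat !inE => /or4P[]->; rewrite ?orbT.
Qed.

Lemma movable_lastP s u : movable_last s u ->
  exists a b, u = a ++ s :: b /\ (forall r, r \in b -> gen_commute s r).
Proof.
elim: u => //= t u IH [/IH[a [b [-> cb]]]|[-> cu]].
  by exists (t :: a), b.
by exists [::], u.
Qed.

(** The key use of the two hypotheses: [w ^+ 2 = 1] turns a first letter into
    a last letter, and a reduced word [s ... s] has a cyclic shift [s s ...]. *)
Lemma CFCI_first_letter w s u : CFCI m w -> reduced_expr (s :: u) w ->
  forall t, t \in u -> gen_commute s t.
Proof.
move=> [cw w2] su.
have suw := su.1.
have fw : fully_commutative w.
  have [w' [<- _]] := cw _ su 0%N.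
  by rewrite rot0 suw.
have rw : reduced_expr (rcons (rev u) s) w.
  apply: (reduced_expr_eq su); last by rewrite size_rcons size_rev.
  rewrite -rev_cons word_val_rev suw; apply/(mulgI w).
  by rewrite mulgV -w2.
have := movable_last_swap (fw _ _ rw su) (movable_last_rcons s (rev u)).
(* If the occurrence of [s] that moves to the end is the first letter, it
   commutes with [u]; otherwise [u = a ++ s :: b] and [s a b s] is reduced. *)
case/movable_lastP=> -[|r a] [b []]; first by case=> -> cb.
case=> _ E cb; case: notF.
have E2 : reduced_expr (rcons (s :: a ++ b) s) w.
  apply: (reduced_expr_eq su); last first.
    by rewrite E size_rcons /= !size_cat /= addnS.
  rewrite -suw E -cats1 !(word_val_cat, word_val_cons).
  by rewrite word_val_nil mulg1 -!mulgA (gen_commute_word cb).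
have [w' [<- ]] := cw _ E2 (size (s :: a ++ b)).
rewrite -cats1 rot_size_cat => E3.
have := cox_length_le (a ++ b).
rewrite -[word_val m (a ++ b)]mul1g -(cox_gen_sq s).
by rewrite -mulgA -!word_val_cons -E3 /= ltnNge leqnSn.
Qed.

(** Once a prefix [p] commutes with all letters, the next letter can be moved to
    the front of the word, where the preceding lemma applies to it. *)
Lemma CFCI_comm_word w u : CFCI m w -> reduced_expr u w -> comm_word u.
Proof.
move=> cw uw.
suff: forall r p, reduced_expr (p ++ r) w ->
    (forall s t, s \in p -> t \in p ++ r -> gen_commute s t) ->
  comm_word (p ++ r) by move/(_ u [::]); apply.
elim=> [|s r IH] p pr cp; first by move: cp; rewrite cats0.
rewrite -cat_rcons; apply: IH; rewrite cat_rcons // => x t.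
rewrite mem_rcons inE => /predU1P[->|xp]; last exact: cp.
have spr : reduced_expr (s :: p ++ r) w.
  apply: (reduced_expr_eq pr); last by rewrite /= !size_cat addnS.
  rewrite -pr.1 word_val_cons !word_val_cat word_val_cons !mulgA.
  rewrite gen_commute_word // => y yp; apply/esym/cp => //.
  by rewrite mem_cat mem_head orbT.
have := CFCI_first_letter cw spr (t := t).
by rewrite !mem_cat inE orbCA => + /predU1P[-> //|]; apply.
Qed.

Lemma CFCI_uniq w u : CFCI m w -> reduced_expr u w -> uniq u.
Proof.
move=> cw uw; have cu := CFCI_comm_word cw uw; apply/negPn/negP => nu.
have [s [v suv]] : exists s v, perm_eq u (s :: s :: v).
  elim: (u) nu => //= s v IH; rewrite negb_and negbK.
  case/orP=> [sv|/IH[t [x tx]]].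
    by exists s, (rem s v); rewrite perm_cons perm_to_rem.
  exists t, (s :: x); rewrite -(perm_cons s) in tx; rewrite (permPl tx).
  by rewrite -[s :: t :: t :: x]/([:: s] ++ [:: t; t] ++ x) perm_catCA.
have := cox_length_le v; rewrite -[word_val m v]mul1g -(cox_gen_sq s).
rewrite -mulgA -!word_val_cons -(perm_word_val cu suv) uw.1 -uw.2.
by rewrite (perm_size suv) /= ltnNge leqnSn.
Qed.

End Words.

(** * The geometric representation *)

(** The lower bound excludes the value 0, which stands for infinity. *)
Definition simply_laced (S : finType) (m : coxeter_matrix S) :=
  forall s t, (0 < m s t <= 3)%N.

Section Reflections.
Variables (S : finType) (m : coxeter_matrix S).
Implicit Types (s t r : S) (u : seq S) (f : S -> int) (A : {set S}).

Definition cartan s t : int :=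
  if m s t == 1%N then 2 else if m s t == 3%N then -1 else 0.

(** [f] stands for the vector with coordinates [f t] in the basis of simple
    roots, and [coroot s] is the linear form that defines the reflection. *)
Definition coroot s f : int := \sum_t cartan s t * f t.

Definition refl s f : S -> int := fun t => f t - coroot s f * (t == s)%:R.

Definition refl_word u f : S -> int := foldr refl f u.

Definition simple_root s : S -> int := fun t => (t == s)%:R.

Lemma reflE s f t : refl s f t = f t - coroot s f * (t == s)%:R.
Proof. by []. Qed.

Lemma coroot_refl s t f :
  coroot s (refl t f) = coroot s f - coroot t f * cartan s t.
Proof.
rewrite /coroot /refl; under eq_bigr do rewrite mulrBr.
rewrite sumrB; congr (_ - _).
rewrite (bigD1 t) //= eqxx mulr1 big1 ?addr0 1?mulrC //.
by move=> r /negPf ->; rewrite !mulr0.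
Qed.

Lemma coroot_simple_root s t : coroot s (simple_root t) = cartan s t.
Proof.
rewrite /coroot /simple_root (bigD1 t) //= eqxx mulr1 big1 ?addr0 //.
by move=> r /negPf ->; rewrite mulr0.
Qed.

Lemma refl_word_notin u s f : s \notin u -> refl_word u f s = f s.
Proof.
elim: u => //= t u IH; rewrite inE negb_or => /andP[/negPf st su].
by rewrite /refl IH // st mulr0 subr0.
Qed.

Lemma refl_simple_root_orth s t :
  m s t = 2%N -> refl s (simple_root t) = simple_root t.
Proof.
move=> mst; apply/funext => r.
by rewrite /refl coroot_simple_root /cartan mst /= mul0r subr0.
Qed.

Hypothesis sl : simply_laced m.

(** After [coroot_refl], both sides are linear in [f r], [coroot s f] and
    [coroot t f], with coefficients depending only on [cartan s t]. *)
Lemma refl_relator s t f : refl_word (relator m s t) f = f.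
Proof.
have mss r : m r r = 1%N by apply/eqP; rewrite cox_mx_eq1.
have css r : cartan r r = 2 by rewrite /cartan mss.
have cts : cartan t s = cartan s t by rewrite /cartan cox_mx_sym.
have := sl s t; rewrite /relator; case E: (m s t) => [|[|[|[|//]]]] // _.
- have /eqP -> : s == t by rewrite -(cox_mx_eq1 m) E.
  apply/funext => r; rewrite /= !reflE coroot_refl css; ring.
- have c0 : cartan s t = 0 by rewrite /cartan E.
  apply/funext => r; rewrite /= !reflE !(coroot_refl, css, cts, c0); ring.
- have c1 : cartan s t = -1 by rewrite /cartan E.
  apply/funext => r; rewrite /= !reflE !(coroot_refl, css, cts, c1); ring.
Qed.

Lemma refl_word_equiv u v :
  word_val m u = word_val m v -> refl_word u =1 refl_word v.
Proof.
rewrite !word_valE => /cox_piP.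
elim=> [_ _ [x s t y]|//|x y _ IH|x y z _ IH1 _ IH2] f.
- rewrite /refl_word !foldr_cat.
  by rewrite -/(refl_word (relator m s t) _) refl_relator.
- by rewrite IH.
- by rewrite IH1.
Qed.

(** If [s] and [t] are joined, then [s t] and [t s] send the simple root of [s]
    to vectors with coordinates 0 and -1 along it. *)
Lemma gen_commute_mx s t : gen_commute m s t -> s != t -> m s t = 2%N.
Proof.
move=> cst; rewrite -(cox_mx_eq1 m); have := sl s t.
case E: (m s t) => [|[|[|[|//]]]] // _ _.
have /refl_word_equiv/(_ (simple_root s))/(congr1 (@^~ s)) :
    word_val m [:: s; t] = word_val m [:: t; s].
  by rewrite !word_val_cons !word_val_nil !mulg1; exact: cst.
have st : (s == t) = false by rewrite -(cox_mx_eq1 m) E.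
rewrite /= !reflE !coroot_refl !coroot_simple_root /cartan /simple_root.
have /eqP -> : m s s == 1%N by rewrite cox_mx_eq1.
by rewrite (cox_mx_sym m t s) E !eqxx /= st.
Qed.

Lemma mx_gen_commute s t : m s t = 2%N -> gen_commute m s t.
Proof.
move=> mst; have : word_val m [:: s; t; s; t] = word_val m [::].
  rewrite !word_valE; apply/cox_piP/rst_step.
  by have := CoxStep m [::] s t [::]; rewrite /relator mst.
rewrite !word_val_cons word_val_nil mulg1 mulgA => stst.
apply: (mulIg (cox_gen m s * cox_gen m t)%g); rewrite stst.
by rewrite -mulgA (mulgA (cox_gen m s)) cox_gen_sq mul1g cox_gen_sq.
Qed.

(** * Products of commuting generators are CFC involutions *)

(** Independent sets of vertices of the Coxeter diagram. *)
Definition commuting_set A :=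
  [forall s in A, forall t in A, (s != t) ==> (m s t == 2%N)].

Lemma commuting_setP A :
  reflect (forall s t, s \in A -> t \in A -> s != t -> m s t = 2%N)
          (commuting_set A).
Proof.
apply: (iffP forall_inP) => cA s.
  by move=> t sA tA st; have /forall_inP/(_ t tA)/implyP/(_ st)/eqP := cA s sA.
by move=> sA; apply/forall_inP => t tA; apply/implyP => st; apply/eqP/cA.
Qed.

Lemma commuting_set_comm_word A u :
  commuting_set A -> {subset u <= A} -> comm_word m u.
Proof.
move=> /commuting_setP cA uA s t /uA sA /uA tA.
by have [->//|st] := eqVneq s t; exact/mx_gen_commute/cA.
Qed.

Definition commuting_prod A : coxeter_group m := word_val m (enum A).

(** Were [s] absent from [v], the coordinate along [s] of the simple root of [s]
    would stay 1; but the product of [A] sends this root to its opposite. *)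
Lemma commuting_prod_support A v :
  commuting_set A -> word_val m v = commuting_prod A -> {subset A <= v}.
Proof.
move=> cA vA s sA; apply/negPn/negP => sv.
have su : s \in enum A by rewrite mem_enum.
have pA := perm_to_rem su; set u := rem s _ in pA.
have vu : word_val m v = word_val m (s :: u).
  rewrite vA; apply: perm_word_val pA.
  by apply: (commuting_set_comm_word cA) => t; rewrite mem_enum.
have us t : t \in u -> m t s = 2%N.
  rewrite mem_rem_uniq ?enum_uniq // inE mem_enum => /andP[ts tA].
  by move/commuting_setP: cA; apply.
have := congr1 (@^~ s) (refl_word_equiv vu (simple_root s)).
rewrite refl_word_notin //= (_ : refl_word u _ = simple_root s); last first.
  elim: (u) us => //= t x IH us; rewrite IH => [|r rx].
    by apply/refl_simple_root_orth/us; exact: mem_head.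
  by apply: us; rewrite inE rx orbT.
rewrite reflE coroot_simple_root /cartan /simple_root.
by rewrite (eqP (_ : m s s == 1%N)) ?cox_mx_eq1 ?eqxx.
Qed.

Lemma cox_length_commuting_prod A :
  commuting_set A -> cox_length (commuting_prod A) = #|A|.
Proof.
move=> cA; apply/eqP; rewrite eqn_leq cardE cox_length_le /=.
have [u [uA <-]] := ex_reduced (commuting_prod A).
apply: uniq_leq_size; first exact: enum_uniq.
by move=> s; rewrite mem_enum; apply: commuting_prod_support.
Qed.

Lemma reduced_commuting_prod_perm A u :
  commuting_set A -> reduced_expr u (commuting_prod A) -> perm_eq u (enum A).
Proof.
move=> cA [uA]; rewrite cox_length_commuting_prod // => su.
have Au : {subset enum A <= u}.
  by move=> s; rewrite mem_enum; exact: commuting_prod_support.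
have uA_size : (size u <= size (enum A))%N by rewrite su -cardE.
have [_ Au_mem] := uniq_min_size (enum_uniq _) Au uA_size.
rewrite perm_sym; apply: uniq_perm (enum_uniq _) _ Au_mem.
exact: leq_size_uniq (enum_uniq _) Au uA_size.
Qed.

Lemma commuting_prod_inj : {in commuting_set &, injective commuting_prod}.
Proof.
move=> A B cA cB AB; apply/setP/subset_eqP/andP.
split; apply/subsetP => s sAB; rewrite -mem_enum.
  exact: (commuting_prod_support cA (v := enum B)).
exact: (commuting_prod_support cB (v := enum A)).
Qed.

Lemma commuting_prod_CFCI A : commuting_set A -> CFCI m (commuting_prod A).
Proof.
move=> cA.
have cP u : perm_eq u (enum A) -> comm_word m u.
  move=> uA; apply: (commuting_set_comm_word cA) => s.
  by rewrite (perm_mem uA) mem_enum.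
split=> [u /(reduced_commuting_prod_perm cA) uA i|].
  have rA : perm_eq (rot i u) (enum A) by rewrite perm_rot.
  exists (commuting_prod A).
    split; first exact: (perm_word_val (cP _ rA)).
    by rewrite size_rot (perm_size uA) -cardE cox_length_commuting_prod.
  move=> x y /(reduced_commuting_prod_perm cA) xA.
  move=> /(reduced_commuting_prod_perm cA) yA.
  by apply: perm_comm_swap (cP _ xA) _; rewrite (permPl xA) perm_sym.
have rA : perm_eq (rev (enum A)) (enum A) by rewrite perm_rev.
rewrite expg2 -{1}[commuting_prod A](perm_word_val (cP _ rA) rA) word_val_rev.
exact: mulVg.
Qed.

Lemma CFCI_commuting_prod w :
  CFCI m w -> exists2 A, commuting_set A & commuting_prod A = w.
Proof.
move=> cw; have [u uw] := ex_reduced w.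
have cu := CFCI_comm_word cw uw.
exists [set s in u].
  apply/commuting_setP => s t; rewrite !inE => su tu.
  by apply: gen_commute_mx; apply: cu.
rewrite -uw.1; apply/esym/perm_word_val => //.
apply: uniq_perm (enum_uniq _) _; first exact: CFCI_uniq cw uw.
by move=> s; rewrite mem_enum inE.
Qed.

End Reflections.

(** * Independence polynomials *)

Section Counting.
Variables (S : finType) (m : coxeter_matrix S).
Implicit Types (s t : S) (A X : {set S}).
Let q : fps int := fpsX int.

Lemma fcoef_sum (R : zmodType) (I : finType) (P : pred I) (F : I -> fps R) k :
  fcoef (\sum_(i | P i) F i) k = \sum_(i | P i) fcoef (F i) k.
Proof. by apply: (big_morph (fun a => fcoef a k)). Qed.

(** The independence polynomial of the subdiagram induced by [X]. *)
Definition commuting_poly X : fps int :=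
  \sum_(A : {set S} | (A \subset X) && commuting_set m A) q ^+ #|A|.

Lemma CFCI_series_commuting :
  simply_laced m -> CFCI_series m = commuting_poly setT.
Proof.
move=> sl; apply: fpsP => k; rewrite fcoef_sum /=.
have bij : functions.set_bij (fun A => commuting_set m A) (CFCI m)
    (commuting_prod m).
  split=> [A|A B|w] /=; first exact: commuting_prod_CFCI.
    by rewrite !classical_sets.in_setE; exact: commuting_prod_inj.
  by move=> /(CFCI_commuting_prod sl)[A cA Aw]; exists A.
rewrite (fsbigop.reindex_fsbig _ _ _ _ bij).
rewrite -(fsbigop.bigfs _ (index_enum_uniq _)) => [|A _]; last first.
  by rewrite mem_index_enum.
apply: eq_big => [A|A cA]; first by rewrite subsetT.
by rewrite cox_length_commuting_prod.
Qed.

Lemma commuting_poly0 : commuting_poly set0 = 1.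
Proof.
rewrite /commuting_poly (big_pred1 set0) ?cards0 ?expr0 // => A.
rewrite subset0 andb_idr // => /eqP ->.
by apply/commuting_setP => s t; rewrite inE.
Qed.

(** Vertex deletion: an independent set that contains [s] is [s] together with
    an independent set of vertices not joined to [s]; [m s t = 2] says that [t]
    is such a vertex, and differs from [s] since [m s s = 1]. *)
Lemma commuting_polyU1 s X : s \notin X ->
  commuting_poly (s |: X) = commuting_poly X
    + q * commuting_poly [set t in X | m s t == 2%N].
Proof.
move=> sX; have mss : m s s = 1%N by apply/eqP; rewrite cox_mx_eq1.
rewrite {1}/commuting_poly (bigID (fun A : {set S} => s \notin A)) /=.
congr (_ + _).
  apply: eq_bigl => A; rewrite andbAC; congr (_ && _).
  by rewrite -subsetD1 setU1K.
rewrite mulr_sumr.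
rewrite (reindex_onto (fun B => s |: B) (fun A => A :\ s)); last first.
  by move=> A; rewrite negbK => /andP[_ sA]; rewrite setD1K.
have nsX (B : {set S}) : B \subset [set t in X | m s t == 2%N] -> s \notin B.
  by move=> BX; apply/negP => /(subsetP BX); rewrite inE mss andbF.
apply: eq_big => [B|B]; last first.
  rewrite setU11 andbT => /andP[_ /eqP BE].
  by rewrite cardsU1 -{1}BE setD11 exprS.
rewrite setU11 andbT.
apply/andP/andP => [[/andP[BX /commuting_setP cB] /eqP BE]|[BX]].
  have sB : s \notin B by rewrite -BE setD11.
  split; last first.
    by apply/commuting_setP => t r tB rB; apply: cB; rewrite inE ?tB ?rB orbT.
  apply/subsetP => t tB; have ts : t != s by apply: contraNneq sB => <-.
  have := subsetP BX t; rewrite !inE tB orbT (negPf ts) => /(_ isT) /= ->.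
  by apply/eqP/cB; rewrite ?inE ?eqxx ?tB ?orbT // eq_sym.
move=> /commuting_setP cB; split; last by rewrite setU1K ?nsX.
rewrite setUS /=; last first.
  by apply: subset_trans BX _; apply/subsetP => t; rewrite inE => /andP[].
apply/commuting_setP => t r; rewrite !inE.
move=> /predU1P[->|tB] /predU1P[->|rB]; rewrite ?eqxx //.
- by move: (subsetP BX _ rB); rewrite inE => /andP[_ /eqP].
- by rewrite cox_mx_sym; move: (subsetP BX _ tB); rewrite inE => /andP[_ /eqP].
- exact: cB.
Qed.

Lemma commuting_polyU1_isolated s X : s \notin X ->
  (forall t, t \in X -> m s t = 2%N) ->
  commuting_poly (s |: X) = (1 + q) * commuting_poly X.
Proof.
move=> sX iso; rewrite commuting_polyU1 // mulrDl mul1r.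
congr (_ + q * commuting_poly _); apply/setP => t; rewrite inE.
by apply: andb_idr => tX; rewrite iso.
Qed.

End Counting.

(** * The affine diagram of type D *)

Section AffineDDiagram.
Variable k : nat.
Let q : fps int := fpsX int.
Implicit Types (g h : affineD_gen k) (i : 'I_(k - 3)).

Lemma affineD_simply_laced : simply_laced (affineD k).
Proof. by move=> g h; rewrite /= /affineD_mx; case: ifP => // _; case: ifP. Qed.

Lemma affineD_eq2 g h :
  (affineD k g h == 2%N) = (h != g) && ~~ affineD_edge g h.
Proof.
rewrite [h == g]eq_sym -[affineD k g h]/(affineD_mx g h) /affineD_mx.
by case: (g == h) => //; case: affineD_edge.
Qed.

Lemma eq_gS g i : (g == gS i) = (if g is gS j then j == i :> nat else false).
Proof. by case: g. Qed.

Lemma eq_gU g b : (g == gU k b) = (if g is gU c then c == b else false).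
Proof. by case: g. Qed.

(** The two leaves [gT] followed by [n - 1] vertices of the path.  The shift
    makes [left_part 0] empty, as needed to delete the vertex that carries the
    leaves: in [left_part 2] all other vertices are neighbours of it. *)
Definition left_part n : {set affineD_gen k} :=
  [set g | match g with gT _ => 0 < n | gS i => i.+1 < n | gU _ => false end]%N.

Fixpoint end_poly n : fps int :=
  match n with
  | 0 => 1
  | 1 => (1 + q) ^+ 2
  | (n'.+1 as n1).+1 => end_poly n1 + q * end_poly n'
  end.

Lemma end_polyS n : end_poly n.+2 = end_poly n.+1 + q * end_poly n.
Proof. by []. Qed.

(** The two isolated leaves give the second value; each further value comes from
    deleting the last path vertex of [left_part n.+2]: without it there remains
    [left_part n.+1], and without its neighbours either, [left_part n]. *)
Lemma left_part_poly n : (n <= (k - 3).+1)%N ->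
  commuting_poly (affineD k) (left_part n) = end_poly n.
Proof.
elim/ltn_ind: n => -[|[|n]] IH nk.
- rewrite (_ : left_part 0 = set0) ?commuting_poly0 //.
  by apply/setP => -[b|j|b]; rewrite !inE.
- rewrite (_ : left_part 1 = gT k true |: (gT k false |: set0)); last first.
    by apply/setP => -[[]|j|b]; rewrite !inE.
  rewrite !commuting_polyU1_isolated ?commuting_poly0 ?mulr1 ?expr2 //.
  + by rewrite inE.
  + by move=> g; rewrite inE.
  + by rewrite !inE.
  + by move=> g; rewrite !inE orbF => /eqP ->.
have nk' : (n < k - 3)%N by [].
pose s := gS (Ordinal nk').
rewrite (_ : left_part n.+2 = s |: left_part n.+1); last first.
  by apply/setP => -[b|j|b]; rewrite !inE ?eq_gS //=; lia.
rewrite commuting_polyU1; last by rewrite inE /= ltnn.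
rewrite end_polyS IH // 1?ltnW // -(IH n) // 1?ltnW // 1?ltnW //.
congr (_ + q * commuting_poly _ _).
apply/setP => g; rewrite !inE affineD_eq2 eq_gS.
case: g => [b|j|b] //=; lia.
Qed.

(** Deletion of the last vertex of the path, which carries the leaves [gU]: if
    it is not chosen, these leaves are isolated and contribute [(1 + q) ^+ 2];
    if it is chosen, they are excluded, as are its other neighbours. *)
Lemma affineD_CFCI_end_poly : (4 <= k)%N ->
  affineD_CFCI k
    = (1 + q) ^+ 2 * end_poly (k - 3) + q * end_poly (k - 4).
Proof.
move=> k4; have k3 : (k - 4 < k - 3)%N by lia.
rewrite /affineD_CFCI (CFCI_series_commuting affineD_simply_laced).
pose s := gS (Ordinal k3).
pose X := gU k true |: (gU k false |: left_part (k - 3)).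
rewrite (_ : [set: _] = s |: X); last first.
  apply/setP => -[b|j|[]]; rewrite !inE ?eq_gS //=; first lia.
  by have := ltn_ord j; lia.
rewrite commuting_polyU1; last first.
  by rewrite !inE /=; lia.
rewrite !commuting_polyU1_isolated.
- rewrite left_part_poly // -(left_part_poly (n := k - 4)); last lia.
  rewrite mulrA expr2.
  congr (_ + q * commuting_poly _ _).
  apply/setP => g; rewrite !inE affineD_eq2 eq_gS.
  case: g => [b|j|b] //=; lia.
- by rewrite !inE.
- by case=> [b|j|b]; rewrite !inE // => jk; apply/eqP;
    rewrite affineD_eq2 eq_gU //= neq_ltn jk.
- by rewrite !inE.
- by case=> [b|j|[]]; rewrite !inE eq_gU //= => jk; apply/eqP;
    rewrite affineD_eq2 eq_gU //= neq_ltn jk.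
Qed.

End AffineDDiagram.

(** * Generating functions *)

Section FpsTheory.
Variable R : comNzRingType.
Implicit Types (a b : fps R) (c d : R).

Lemma fcoefD a b n : fcoef (a + b) n = fcoef a n + fcoef b n.
Proof. by []. Qed.

Lemma fcoefN a n : fcoef (- a) n = - fcoef a n.
Proof. by []. Qed.

Lemma fcoefC0 c : fcoef (fpsC c) 0 = c.
Proof. by []. Qed.

Lemma fcoefCS c n : fcoef (fpsC c) n.+1 = 0.
Proof. by []. Qed.

Lemma fcoefCM c a n : fcoef (fpsC c * a) n = c * fcoef a n.
Proof.
rewrite [LHS]big_ord_recl /= subn0 big1 ?addr0 // => i _.
by rewrite mul0r.
Qed.

Lemma fcoefXM a n : fcoef (fpsX R * a) n = if n is k.+1 then fcoef a k else 0.
Proof.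
rewrite [LHS]big_ord_recl /= mul0r add0r.
case: n => [|n]; first by rewrite big_ord0.
rewrite big_ord_recl /= mul1r subSS subn0 big1 ?addr0 // => i _.
by rewrite mul0r.
Qed.

Lemma fpsCM c d : fpsC (c * d) = fpsC c * fpsC d.
Proof. by apply: fpsP => n; rewrite fcoefCM /=; case: eqP; rewrite ?mulr0. Qed.

Lemma fpsCB c d : fpsC (c - d) = fpsC c - fpsC d.
Proof. by apply: fpsP => n /=; case: eqP; rewrite ?subr0. Qed.

HB.instance Definition _ :=
  GRing.isZmodMorphism.Build R (fps R) (@fpsC R) fpsCB.
HB.instance Definition _ := GRing.isMonoidMorphism.Build R (fps R) (@fpsC R)
  (conj (erefl : fpsC 1 = 1) fpsCM).

End FpsTheory.

Lemma affineD_CFCI_rec n : (4 <= n)%N ->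
  affineD_CFCI n.+2 = affineD_CFCI n.+1 + fpsX int * affineD_CFCI n.
Proof.
case: n => [|[|[|[|n]]]] // _; rewrite !affineD_CFCI_end_poly //.
rewrite !subSS !subn0 !end_polyS; ring.
Qed.

Lemma affineD4_CFCI (q := fpsX int) :
  affineD_CFCI 4 = 1 + 5 * q + 6 * q ^+ 2 + 4 * q ^+ 3 + q ^+ 4.
Proof. rewrite affineD_CFCI_end_poly //= -/q; ring. Qed.

Lemma affineD5_CFCI (q := fpsX int) :
  affineD_CFCI 5 = 1 + 6 * q + 10 * q ^+ 2 + 6 * q ^+ 3 + q ^+ 4.
Proof. rewrite affineD_CFCI_end_poly //= -/q; ring. Qed.

Theorem theorem4p7 :
  let q : fps int := fpsX int in
  let x : fps (fps int) := fpsX (fps int) in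
  let Q : fps (fps int) := fpsC q in
  [/\ forall n : nat, (4 <= n)%N ->
        affineD_CFCI n.+2 = affineD_CFCI n.+1 + q * affineD_CFCI n,
      affineD_CFCI 4 = 1 + 5 * q + 6 * q ^+ 2 + 4 * q ^+ 3 + q ^+ 4,
      affineD_CFCI 5 = 1 + 6 * q + 10 * q ^+ 2 + 6 * q ^+ 3 + q ^+ 4 &
      affineD_CFCI_gf =
        x ^+ 2 * ((1 + 5 * Q + 6 * Q ^+ 2 + 4 * Q ^+ 3 + Q ^+ 4
                   + x * (Q + 4 * Q ^+ 2 + 2 * Q ^+ 3))
                  / (1 - x - Q * x ^+ 2))].
Proof.
move=> q x Q; split.
- exact: affineD_CFCI_rec.
- exact: affineD4_CFCI.
- exact: affineD5_CFCI.
have num : 1 + 5 * Q + 6 * Q ^+ 2 + 4 * Q ^+ 3 + Q ^+ 4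
             + x * (Q + 4 * Q ^+ 2 + 2 * Q ^+ 3)
    = fpsC (affineD_CFCI 4) + x * fpsC (affineD_CFCI 5 - affineD_CFCI 4).
  rewrite affineD4_CFCI affineD5_CFCI /Q /q; ring.
have den : 1 - x - Q * x ^+ 2 = 1 - x * (1 + Q * x) by ring.
have unit_den : 1 - x * (1 + Q * x) \is a GRing.unit.
  by apply: fps_unit_coef0; rewrite fcoefD fcoefN fcoefXM oppr0 addr0.
rewrite num den mulrA; apply: (mulIr unit_den); rewrite divrK //.
rewrite mulrBr mulr1 expr2 -mulrA.
(* Factors [x] are brought to the front, where they only shift coefficients. *)
have -> : affineD_CFCI_gf * (x * (1 + Q * x))
   = x * (affineD_CFCI_gf + Q * (x * affineD_CFCI_gf)) by ring.
apply: fpsP => n; rewrite fcoefD fcoefN !fcoefXM.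
have gf0 : fcoef affineD_CFCI_gf 0 = 0 by [].
have gf1 : fcoef affineD_CFCI_gf 1 = 0 by [].
have gf2 i : fcoef affineD_CFCI_gf i.+2 = affineD_CFCI i.+4 by [].
case: n => [|[|[|[|n]]]]; rewrite ?fcoefXM ?fcoefD ?fcoefCM ?fcoefXM.
- by rewrite gf0 subr0.
- by rewrite gf0 gf1; ring.
- by rewrite gf2 gf1 gf0 fcoefC0; ring.
- by rewrite !gf2 gf1 fcoefCS fcoefC0; ring.
- by rewrite !gf2 !fcoefCS (affineD_CFCI_rec (n := n.+4)) // /q; ring.
Qed.
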